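(* Let $m\ge1$, $r\ge0$ be integers and let $P\in LPDO_r$ satisfy $\mathrm{finsupp}(P)=\mathbb R^m$. Then there exists a *infinite dimensional ${}^*\mathbb R$-linear subspace ${}^\sigma\mathfrak I_P$ of ${}^*C^\infty(\mathbb R^m,\mathbb R)$ such that for every $g\in{}^\sigma\mathfrak I_P$ there exists $f\in{}^*C^\infty(\mathbb R^m,\mathbb R)$ such that $${}^*j^k_{{}^*x}({}^*P(f))={}^*j^k_{{}^*x}\,g\qquad\text{for every }x\in\mathbb R^m\text{ and every standard integer }k\ge0 .$$
   Context: Nonstandard setting: a fixed superstructure nonstandard extension $*$ that is polysaturated ($\kappa$-saturated with $\kappa$ larger than the cardinality of the standard superstructure). ${}^*C^\infty(\mathbb R^m,\mathbb R)$ is the set of internal *smooth functions ${}^*\mathbb R^m\to{}^*\mathbb R$; it is a ${}^*\mathbb R$-vector space. Subspaces may be external. A (possibly external) ${}^*\mathbb R$-subspace is called *infinite dimensional if for every $N\in{}^*\mathbb N$ it contains an internal *finite dimensional subspace of *dimension $N$. $LPDO_r$ is the space of linear partial differential operators $P=\sum_{|\alpha|\le r}f_\alpha\partial^\alpha$ with $f_\alpha\in C^\infty(\mathbb R^m,\mathbb R)$. $\mathrm{finsupp}(P)$ is the set of $x\in\mathbb R^m$ at which the symbol does not vanish to infinite order, i.e. such that $\partial^\beta f_\alpha(x)\ne0$ for some $|\alpha|\le r$ and some multiindex $\beta$ (with $\beta=0$ allowed). $j^k_xf$ denotes the $k$-jet of $f$ at $x$ (the collection of all partial derivatives of order $\le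 k$ at $x$), and ${}^*j^k_\xi$ its transfer. *)

(* Defs.v *)
From HB Require Import structures.
From mathcomp Require Import all_boot all_order all_algebra.
From mathcomp Require Import all_classical all_reals all_analysis.
Set Implicit Arguments.
Unset Strict Implicit.
Unset Printing Implicit Defensive.
Import numFieldNormedType.Exports.
Local Open Scope classical_set_scope.
Local Open Scope card_scope.
Local Open Scope ring_scope.

(* The usual hierarchy V_0 = X, V_(n+1) = V_n `|` P(V_n) over the atoms [X]. *)
Fixpoint ss_level (U X : Type) (ss_mem : U -> U -> Prop) (ss_atom : X -> U)
  (n : nat) : set U :=
  if n is k.+1 then
    ss_level ss_mem ss_atom k `|`
    [set a | ~ range ss_atom a /\
             forall b, ss_mem b a -> ss_level ss_mem ss_atom k b]
  else range ss_atom.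

(* The superstructure V(X) = \bigcup_n V_n over a set of atoms [X], given by
   the axioms that determine it up to a unique isomorphism over [X]: atoms are
   distinct and have no elements, sets are extensional, every element lies in
   some V_n, and every subset of every V_n is (the extension of) an element. *)
Record superstructure (X : Type) := Superstructure {
  ss_sort :> Type;
  ss_mem : ss_sort -> ss_sort -> Prop;
  ss_atom : X -> ss_sort;
  ss_atom_inj : injective ss_atom;
  ss_mem_atom : forall (a : ss_sort) (x : X), ~ ss_mem a (ss_atom x);
  ss_ext : forall a b : ss_sort, ~ range ss_atom a -> ~ range ss_atom b ->
    (forall c, ss_mem c a <-> ss_mem c b) -> a = b;
  ss_rank : forall a : ss_sort, exists n, ss_level ss_mem ss_atom n a;
  ss_compr : forall (n : nat) (A : set ss_sort),
    A `<=` ss_level ss_mem ss_atom n ->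
    exists b, ~ range ss_atom b /\ forall c, ss_mem c b <-> A c
}.

Arguments ss_mem {X s}.
Arguments ss_atom {X} s.

Lemma mkset_subproof (X : Type) (V : superstructure X) (A : set V) :
  exists b : V, (exists n, A `<=` ss_level ss_mem (ss_atom V) n) ->
    ~ range (ss_atom V) b /\ forall c, ss_mem c b <-> A c.
Proof.
have [[n An]|nA] := pselect (exists n, A `<=` ss_level ss_mem (ss_atom V) n).
  by have [b bP] := ss_compr An; exists b.
have [b _] := @ss_compr X V 0%N set0 (@sub0set _ _).
by exists b => /nA.
Qed.

(* The element of V(X) with extension [A]; unspecified if [A] has unbounded
   rank, which happens for none of the sets formed below. *)
Definition mkset (X : Type) (V : superstructure X) (A : set V) : V :=
  sval (cid (mkset_subproof A)).

(* Kuratowski pairs *)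
Definition opair (X : Type) (V : superstructure X) (a b : V) : V :=
  mkset [set mkset [set a]; mkset [set a; b]].

Lemma app_subproof (X : Type) (V : superstructure X) (F a : V) :
  exists b : V, (exists c, ss_mem (opair a c) F) -> ss_mem (opair a b) F.
Proof.
have [[c cP]|nc] := pselect (exists c, ss_mem (opair a c) F); first by exists c.
by exists a => /nc.
Qed.

(* The value at [a] of a function [F] that is an element of V(X) *)
Definition app (X : Type) (V : superstructure X) (F a : V) : V :=
  sval (cid (app_subproof F a)).

(* The graph, as an element of V(X), of the restriction to [D] of
   [f : A -> B], with A and B coded in V(X) by [cA] and [cB] *)
Definition graph (X : Type) (V : superstructure X) (A B : Type)
  (cA : A -> V) (cB : B -> V) (D : set A) (f : A -> B) : V :=
  mkset [set opair (cA a) (cB (f a)) | a in D].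

(* Bounded formulas of the language of set theory, with variables in [nat];
   [FAll i j phi] is "for all x_i in x_j, phi". *)
Inductive bformula : Type :=
| FMem of nat & nat
| FEq of nat & nat
| FNot of bformula
| FAnd of bformula & bformula
| FOr of bformula & bformula
| FImp of bformula & bformula
| FAll of nat & nat & bformula
| FEx of nat & nat & bformula.

Definition upd (T : Type) (e : nat -> T) (i : nat) (a : T) : nat -> T :=
  fun k => if k == i then a else e k.

Fixpoint sat (X : Type) (V : superstructure X) (e : nat -> V) (phi : bformula)
  : Prop :=
  match phi with
  | FMem i j => ss_mem (e i) (e j)
  | FEq i j => e i = e j
  | FNot p => ~ sat e p
  | FAnd p q => sat e p /\ sat e q
  | FOr p q => sat e p \/ sat e q
  | FImp p q => sat e p -> sat e q
  | FAll i j p => forall a, ss_mem a (e j) -> sat (upd e i a) p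
  | FEx i j p => exists a, ss_mem a (e j) /\ sat (upd e i a) p
  end.

(* A nonstandard extension * : V(X) -> V(Y) with Y = *X. *)
Record nonstandard_extension (X Y : Type)
    (V : superstructure X) (W : superstructure Y) := NonstandardExtension {
  star :> V -> W;
  star_atoms : star (mkset (range (ss_atom V))) = mkset (range (ss_atom W));
  star_transfer : forall (phi : bformula) (e : nat -> V),
    sat e phi <-> sat (star \o e) phi
}.

Definition internal (X Y : Type) (V : superstructure X) (W : superstructure Y)
  (star : nonstandard_extension V W) : set W :=
  [set a | exists A : V, ss_mem a (star A)].

(* kappa-saturation, the cardinal kappa being that of the type [K]. *)
Definition saturated (X Y : Type) (V : superstructure X) (W : superstructure Y)
  (star : nonstandard_extension V W) (K : Type) : Prop :=
  forall (I : Type) (F : I -> W),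
    ~ ([set: K] #<= [set: I]) ->
    (forall i, internal star (F i) /\ ~ range (ss_atom W) (F i)) ->
    (forall J : set I, finite_set J ->
       exists a, forall i, J i -> ss_mem a (F i)) ->
    exists a, forall i, ss_mem a (F i).

Definition polysaturated (X Y : Type)
  (V : superstructure X) (W : superstructure Y)
  (star : nonstandard_extension V W) : Prop :=
  exists K : Type, ~ ([set: K] #<= [set: V]) /\ saturated star K.

Definition partial (R : realType) (m : nat) (i : 'I_m) (f : 'rV[R]_m -> R)
  : 'rV[R]_m -> R :=
  fun x => 'D_(delta_mx 0 i) f x.

Definition pderiv (R : realType) (m : nat) (b : 'I_m -> nat)
  (f : 'rV[R]_m -> R) : 'rV[R]_m -> R :=
  foldr (fun i => iter (b i) (partial i)) f (enum 'I_m).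

(* C^oo: all iterated partial derivatives exist and are continuous. *)
Definition smooth (R : realType) (m : nat) : set ('rV[R]_m -> R) :=
  [set f | forall s : seq 'I_m, let g := foldr (@partial R m) f s in
    continuous g /\ forall (i : 'I_m) x, derivable g x (delta_mx 0 i)].
Arguments smooth : clear implicits.

(* Multi-indices of order at most [k] *)
Definition midx (m k : nat) : finType :=
  {a : {ffun 'I_m -> 'I_k.+1} | (\sum_i a i <= k)%N}.

Definition midx_fun (m k : nat) (a : midx m k) : 'I_m -> nat :=
  fun i => val a i.

Definition jet (R : realType) (m k : nat) (x : 'rV[R]_m) (f : 'rV[R]_m -> R)
  : midx m k -> R :=
  fun a => pderiv (midx_fun a) f x.

Record LPDO (R : realType) (m r : nat) := MkLPDO {
  coef : midx m r -> 'rV[R]_m -> R;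
  coef_smooth : forall a, smooth R m (coef a)
}.

Definition lpdo_op (R : realType) (m r : nat) (P : LPDO R m r)
  (f : 'rV[R]_m -> R) : 'rV[R]_m -> R :=
  fun x => \sum_(a : midx m r) coef P a x * pderiv (midx_fun a) f x.

Definition finsupp (R : realType) (m r : nat) (P : LPDO R m r)
  : set 'rV[R]_m :=
  [set x | exists (a : midx m r) (b : 'I_m -> nat),
    pderiv b (coef P a) x != 0].

(* [E] is a linear subspace of dimension [n] of the space of functions on R^m:
   it is the span of [n] linearly independent functions. *)
Definition subspace_of_dim (R : realType) (m : nat) (n : nat)
  (E : set ('rV[R]_m -> R)) : Prop :=
  exists b : 'I_n -> 'rV[R]_m -> R,
    (forall c : 'I_n -> R,
       (forall x, \sum_i c i * b i x = 0) -> forall i, c i = 0) /\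
    E = [set f | exists c : 'I_n -> R, f = fun x => \sum_i c i * b i x].

(* Codes in V(X), where the set X of atoms contains a copy [io] of the reals;
   natural numbers are coded as reals, functions as their graphs. *)

Section Codes.
Context (R : realType) (X : Type) (io : R -> X) (V : superstructure X).
Context (m : nat).
Local Notation fct := ('rV[R]_m -> R).

Definition code_real (t : R) : V := ss_atom V (io t).

Definition code_nat (n : nat) : V := code_real n%:R.

Definition code_point (x : 'rV[R]_m) : V :=
  graph (fun i : 'I_m => code_nat i) code_real setT (fun i => x 0 i).

Definition code_fun (f : fct) : V := graph code_point code_real setT f.

Definition code_midx (k : nat) (a : midx m k) : V :=
  graph (fun i : 'I_m => code_nat i) code_nat setT (midx_fun a).

Definition code_jet (k : nat) (j : midx m k -> R) : V :=
  graph (@code_midx k) code_real setT j.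

Definition reals_ : V := mkset (range code_real).

Definition nats_ : V := mkset (range code_nat).

Definition smooth_ : V := mkset (code_fun @` smooth R m).

Definition add_ : V :=
  graph (fun p : fct * fct => opair (code_fun p.1) (code_fun p.2)) code_fun
    (smooth R m `*` smooth R m) (fun p => fun x => p.1 x + p.2 x).

Definition scale_ : V :=
  graph (fun p : R * fct => opair (code_real p.1) (code_fun p.2)) code_fun
    (setT `*` smooth R m) (fun p => fun x => p.1 * p.2 x).

(* The relation { (n, E) | E is an n-dimensional subspace of C^oo(R^m, R) } *)
Definition findim_ : V :=
  mkset [set q | exists (n : nat) (E : set fct),
    [/\ E `<=` smooth R m, subspace_of_dim n E &
        q = opair (code_nat n) (mkset (code_fun @` E))]].

Definition lpdo_ (r : nat) (P : LPDO R m r) : V :=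
  graph code_fun code_fun (smooth R m) (lpdo_op P).

(* The map (x, f) |-> j^k_x f on R^m x C^oo(R^m, R) *)
Definition jet_ (k : nat) : V :=
  graph (fun p : 'rV[R]_m * fct => opair (code_point p.1) (code_fun p.2))
    (@code_jet k) (setT `*` smooth R m) (fun p => @jet R m k p.1 p.2).

End Codes.

Section StarSubspaces.
Context (R : realType) (X : Type) (io : R -> X) (V : superstructure X).
Context (Y : Type) (W : superstructure Y) (star : nonstandard_extension V W).
Context (m : nat).

(* [I] is a possibly external *R-linear subspace of *C^oo(R^m, R). *)
Definition star_subspace (I : set W) : Prop :=
  [/\ forall f, I f -> ss_mem f (star (smooth_ io V m)),
      I (star (code_fun io V (fun _ : 'rV[R]_m => 0))),
      forall f g, I f -> I g -> I (app (star (add_ io V m)) (opair f g)) &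
      forall c f, ss_mem c (star (reals_ io V)) -> I f ->
        I (app (star (scale_ io V m)) (opair c f))].

Definition star_infinite_dim (I : set W) : Prop :=
  forall N, ss_mem N (star (nats_ io V)) ->
    exists E : W, ss_mem (opair N E) (star (findim_ io V m)) /\
      forall f, ss_mem f E -> I f.

(* *j^k_{*x} f, for x in R^m, k a standard natural number, f in *C^oo *)
Definition star_jet (k : nat) (x : 'rV[R]_m) (f : W) : W :=
  app (star (jet_ io V m k)) (opair (star (code_point io V x)) f).

(* *P f *)
Definition star_lpdo (r : nat) (P : LPDO R m r) (f : W) : W :=
  app (star (lpdo_ io V P)) f.

End StarSubspaces.

(* V(X) is realized as the quotient by extensional equality of the iterated
   powersets [X + sub_lev n] of [X]. *)

Section Existence.
Context (X : Type).

Fixpoint sub_lev (n : nat) : Type :=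
  if n is k.+1 then (X + sub_lev k)%type -> Prop else False.
Let lev n : Type := (X + sub_lev n)%type.

Let eql (S T : Type) (r : S -> T -> Prop) (a : X + S) (b : X + T) : Prop :=
  match a, b with
  | inl x, inl y => x = y
  | inr A, inr B => r A B
  | _, _ => False
  end.

Fixpoint eqs (n k : nat) : sub_lev n -> sub_lev k -> Prop :=
  match n, k with
  | n'.+1, k'.+1 => fun A B =>
     (forall a, A a -> exists b, B b /\ eql (@eqs n' k') a b) /\
     (forall b, B b -> exists a, A a /\ eql (@eqs n' k') a b)
  | _, _ => fun _ _ => False
  end.

Let Z : Type := {n : nat & lev n}.
Let eqZ (a b : Z) : Prop :=
  eql (@eqs (projT1 a) (projT1 b)) (projT2 a) (projT2 b).

Let eql_refl n (a : lev n) : eql (@eqs n n) a a.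
Proof.
elim: n a => [|n IH] [x|A] //=.
by split=> a Aa; exists a; split=> //; exact: IH.
Qed.

Let eql_sym n k (a : lev n) (b : lev k) :
  eql (@eqs n k) a b -> eql (@eqs k n) b a.
Proof.
elim: n k a b => [|n IH] [|k] [x|A] [y|B] //= [AB BA].
split=> [b /BA[a [Aa ab]]|a /AB[b [Bb ab]]].
  by exists a; split=> //; exact: IH.
by exists b; split=> //; exact: IH.
Qed.

Let eql_trans n k l (a : lev n) (b : lev k) (c : lev l) :
  eql (@eqs n k) a b -> eql (@eqs k l) b c -> eql (@eqs n l) a c.
Proof.
elim: n k l a b c => [|n IH] [|k] [|l] [x|A] [y|B] [z|C] //=;
  try by move=> -> ->.
move=> [AB BA] [BC CB]; split.
  move=> a /AB[b [/BC[c [Cc bc]] ab]]; exists c; split=> //; exact: IH ab bc.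
move=> c /CB[b [/BA[a [Aa ab]] bc]]; exists a; split=> //; exact: IH ab bc.
Qed.

Let car : Type := {C : set Z | exists z, C = eqZ z}.
Let cls (z : Z) : car := exist _ (eqZ z) (ex_intro _ z erefl).

Let clsP (z w : Z) : cls z = cls w <-> eqZ z w.
Proof.
split=> [/(congr1 sval) /= zw|zw].
  by rewrite zw; exact: eql_refl.
apply: eq_exist => /=; apply/funext => u; apply/propext; split.
  by move=> zu; apply: eql_trans (eql_sym zw) zu.
by move=> wu; apply: eql_trans zw wu.
Qed.

Let cls_surj (c : car) : exists z, c = cls z.
Proof. by case: c => C [z Cz]; exists z; apply: eq_exist. Qed.

Let mem_car (a b : car) : Prop :=
  exists n (B : sub_lev n.+1) (c : lev n),
    [/\ b = cls (existT _ n.+1 (inr B)), a = cls (existT _ n c) & B c].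

Let atom_car (x : X) : car := cls (existT _ 0%N (inl x)).

Let mem_carP (a : car) n (B : sub_lev n.+1) :
  mem_car a (cls (existT _ n.+1 (inr B))) <->
  exists c : lev n, a = cls (existT _ n c) /\ B c.
Proof.
split=> [[k [D [d [BD ad Dd]]]]|[c [ac Bc]]]; last by exists n, B, c.
move/clsP: BD => [_ DB]; have [c [Bc cd]] := DB d Dd.
exists c; split=> //; rewrite ad; apply/clsP; exact: eql_sym cd.
Qed.

Let set_car n (B : sub_lev n.+1) :
  ~ range atom_car (cls (existT _ n.+1 (inr B))).
Proof. by case=> x _ /clsP. Qed.

Let car_cases (c : car) : range atom_car c \/
  exists n (B : sub_lev n.+1), c = cls (existT _ n.+1 (inr B)).
Proof.
have [[n [x|B]] ->] := cls_surj c.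
  by left; exists x => //; apply/clsP.
by case: n B => [[]|n B]; right; exists n, B.
Qed.

Let level_car n (c : lev n) : ss_level mem_car atom_car n (cls (existT _ n c)).
Proof.
elim: n c => [|n IH] [x|B] //; first by exists x.
  left; have := IH (inl x); congr (ss_level _ _ _ _).
  by apply/clsP.
right; split; first exact: set_car.
by move=> b /mem_carP[c [-> _]].
Qed.

Let level_rep n (a : car) :
  ss_level mem_car atom_car n a -> exists c : lev n, a = cls (existT _ n c).
Proof.
elim: n a => [a [x _ <-]|n IH a [/IH[[x|B] ->]|[na ab]]].
- by exists (inl x).
- by exists (inl x); apply/clsP.
- case: n B IH => [[]|n B IH].
  pose D : sub_lev n.+2 := fun d =>
    exists c : lev n, B c /\ eqZ (existT _ n c) (existT _ n.+1 d).
  exists (inr D); apply/clsP; split=> [c Bc|d [c [Bc cd]]]; last by exists c.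
  have [d cd] := IH _ (or_introl (level_car c)).
  by move/clsP: cd => cd; exists d; split=> //; exists c.
- have [//|[k [B aB]]] := car_cases a.
  pose D : sub_lev n.+1 := fun d => mem_car (cls (existT _ n d)) a.
  exists (inr D); rewrite aB; apply/clsP; split=> [b Bb|d].
    have ba : mem_car (cls (existT _ k b)) a
      by rewrite aB; apply/mem_carP; exists b.
    have [d bd] := IH _ (ab _ ba).
    by exists d; split; [rewrite /D -bd|exact: (proj1 (clsP _ _) bd)].
  by rewrite /D aB => /mem_carP[b [db Bb]]; exists b;
      split=> //; exact: (proj1 (clsP _ _) (esym db)).
Qed.

Lemma superstructure_exists : inhabited (superstructure X).
Proof.
constructor; apply: (@Superstructure X car mem_car atom_car).
- by move=> x y /clsP.
- by move=> a x [n [B [c [/clsP]]]].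
- move=> a b na nb ab.
  have [//|[n [A aA]]] := car_cases a; have [//|[k [B bB]]] := car_cases b.
  rewrite aA bB; apply/clsP; split=> [c Ac|d Bd].
    have /ab : mem_car (cls (existT _ n c)) a
      by rewrite aA; apply/mem_carP; exists c.
    by rewrite bB => /mem_carP[d [cd Bd]]; exists d;
      split=> //; exact: (proj1 (clsP _ _) cd).
  have /ab : mem_car (cls (existT _ k d)) b
      by rewrite bB; apply/mem_carP; exists d.
  rewrite aA => /mem_carP[c [cd Ac]]; exists c; split=> //.
  exact: (proj1 (clsP _ _) (esym cd)).
- by move=> a; have [[n c] ->] := cls_surj a; exists n; exact: level_car.
- move=> n A An.
  exists (cls (existT _ n.+1 (inr (fun d : lev n => A (cls (existT _ n d)))))).
  split; first exact: set_car.
  move=> c; split=> [/mem_carP[d [-> //]]|Ac].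
  have [d cd] := level_rep (An _ Ac).
  by apply/mem_carP; exists d; rewrite -cd.
Qed.

End Existence.

(* Main.v *)
(* The required space consists of the values of *P on *C^oo(R^m, R), so that
   *P f = g holds exactly and not only to infinite order at the standard points.
   It is *infinite dimensional by transfer of the fact that the image of P
   contains subspaces of every finite dimension n. For the latter, P has a
   nonzero coefficient at some point, hence at n points of a small segment, and
   Hermite interpolation provides polynomials f_1, ..., f_n such that P f_j is
   nonzero at the j-th point and vanishes at the others. *)

Require Import Defs.
From HB Require Import structures.
From mathcomp Require Import all_boot all_order all_algebra.
From mathcomp Require Import all_classical all_reals all_analysis.
Set Implicit Arguments.
Unset Strict Implicit.
Unset Printing Implicit Defensive.
Import numFieldNormedType.Exports.
Import Defs.
Import Order.TTheory GRing.Theory Num.Theory.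
Local Open Scope classical_set_scope.
Local Open Scope ring_scope.

(** * Closure properties of smooth functions and linearity of iterated partial derivatives *)

Section SmoothFunctions.
Context (R : realType) (m : nat).
Local Notation fct := ('rV[R]_m -> R).
Implicit Types (f g : fct) (x : 'rV[R]_m) (i : 'I_m).

(** Smoothness concerns every finite list of partial derivatives. A class closed under [partial]
    contains all of them, so checking one derivative at a time suffices. *)
Lemma smooth_coind (K : set fct) :
  (forall f, K f -> [/\ continuous f,
     forall i x, derivable f x (delta_mx 0 i) & forall i, K (partial i f)]) ->
  K `<=` smooth R m.
Proof.
move=> HK f Kf s /=.
have : K (foldr (@partial R m) f s).
  by elim: s => //= i s /HK[_ _]; apply.
by move=> /HK[].
Qed.

Lemma smooth_continuous f : smooth R m f -> continuous f.
Proof. by move=> /(_ [::]) []. Qed.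

Lemma smooth_derivable f i x :
  smooth R m f -> derivable f x (delta_mx 0 i).
Proof. by move=> /(_ [::]) [_]; apply. Qed.

(** [foldr] applies the end of the list first, so appending [i] differentiates along [i] before
    everything in [s]. *)
Lemma smooth_partial f i : smooth R m f -> smooth R m (partial i f).
Proof. by move=> fs s; have := fs (rcons s i); rewrite foldr_rcons. Qed.

Lemma smooth_iter_partial n i f :
  smooth R m f -> smooth R m (iter n (partial i) f).
Proof. by move=> fs; elim: n => [|n IH]; [exact: fs|exact: smooth_partial]. Qed.

Lemma smooth_pderiv (b : 'I_m -> nat) f :
  smooth R m f -> smooth R m (pderiv b f).
Proof.
rewrite /pderiv; move: (enum _) => s fs.
by elim: s => [|i s IH]; [exact: fs|exact: smooth_iter_partial].
Qed.

Lemma partialD i f g : smooth R m f -> smooth R m g ->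
  partial i (f \+ g) = partial i f \+ partial i g.
Proof.
by move=> fs gs; apply/funext => x; rewrite /partial deriveD//;
  exact: smooth_derivable.
Qed.

Lemma partialZ i (c : R) f : smooth R m f ->
  partial i (fun x => c * f x) = fun x => c * partial i f x.
Proof.
by move=> fs; apply/funext => x; rewrite /partial deriveZ//;
  exact: smooth_derivable.
Qed.

(* Unlike [smooth], this inductive form is visibly stable under [partial], by
   the Leibniz rule; it is contained in [smooth] by coinduction. *)
Inductive smooth_alg : fct -> Prop :=
| smooth_alg_smooth f : smooth R m f -> smooth_alg f
| smooth_alg_cst c : smooth_alg (cst c)
| smooth_algD f g : smooth_alg f -> smooth_alg g -> smooth_alg (f \+ g)
| smooth_algM f g : smooth_alg f -> smooth_alg g -> smooth_alg (f \* g).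

Lemma smooth_alg_sub : smooth_alg `<=` smooth R m.
Proof.
apply: smooth_coind => f.
elim=> {f} [f fs|c|f g _ [cf df pf] _ [cg dg pg]|
  f g fa [cf df pf] ga [cg dg pg]].
- split=> [|i x|i]; first exact: smooth_continuous.
    exact: smooth_derivable.
  by constructor; exact: smooth_partial.
- split=> [|i x|i]; first exact: cst_continuous.
    exact: derivable_cst.
  rewrite (_ : partial _ _ = cst 0); first exact: smooth_alg_cst.
  by apply/funext => x; rewrite /partial derive_cst.
- split=> [x|i x|i]; first exact: cvgD (cf x) (cg x).
    exact: derivableD.
  rewrite (_ : partial _ _ = partial i f \+ partial i g).
    exact: smooth_algD.
  by apply/funext => x; rewrite /partial deriveD.
- split=> [x|i x|i]; first exact: cvgM (cf x) (cg x).
    exact: derivableM.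
  rewrite (_ : partial _ _ = (f \* partial i g) \+ (g \* partial i f)).
    by apply: smooth_algD; apply: smooth_algM.
  by apply/funext => x; rewrite /partial deriveM.
Qed.

Lemma smooth_cst c : smooth R m (cst c).
Proof. by apply: smooth_alg_sub; exact: smooth_alg_cst. Qed.

Lemma smoothD f g : smooth R m f -> smooth R m g -> smooth R m (f \+ g).
Proof.
by move=> fs gs; apply: smooth_alg_sub; apply: smooth_algD; constructor.
Qed.

Lemma smoothM f g : smooth R m f -> smooth R m g -> smooth R m (f \* g).
Proof.
by move=> fs gs; apply: smooth_alg_sub; apply: smooth_algM; constructor.
Qed.

Lemma smoothZ (c : R) f : smooth R m f -> smooth R m (fun x => c * f x).
Proof. exact/smoothM/smooth_cst. Qed.

Lemma smooth_sum (I : Type) (s : seq I) (F : I -> fct) :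
  (forall k, smooth R m (F k)) -> smooth R m (fun x => \sum_(k <- s) F k x).
Proof.
move=> Fs; elim: s => [|k s IH].
  rewrite (_ : (fun x => _) = cst 0); first exact: smooth_cst.
  by apply/funext => x; rewrite big_nil.
rewrite (_ : (fun x => _) = F k \+ (fun x => \sum_(j <- s) F j x)).
  by apply: smoothD; [exact: Fs|exact: IH].
by apply/funext => x; rewrite big_cons.
Qed.

Lemma iter_partialD n i f g : smooth R m f -> smooth R m g ->
  iter n (partial i) (f \+ g) = iter n (partial i) f \+ iter n (partial i) g.
Proof.
move=> fs gs; elim: n => [|n IH]; first by [].
rewrite !iterS IH; apply: partialD; exact: smooth_iter_partial.
Qed.

Lemma iter_partialZ n i (c : R) f : smooth R m f ->
  iter n (partial i) (fun x => c * f x) = fun x => c * iter n (partial i) f x.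
Proof.
move=> fs; elim: n => [|n IH]; first by [].
rewrite !iterS IH; apply: partialZ; exact: smooth_iter_partial.
Qed.

Lemma pderivD (b : 'I_m -> nat) f g : smooth R m f -> smooth R m g ->
  pderiv b (f \+ g) = pderiv b f \+ pderiv b g.
Proof.
rewrite /pderiv; move: (enum _) => s fs gs.
pose D (h : fct) : fct := foldr (fun i => iter (b i) (partial i)) h s.
(* Additivity of one more partial derivative needs derivable summands, so the induction on the list
   carries the smoothness of [D f] and [D g] along. *)
suff [_ _] : [/\ smooth R m (D f), smooth R m (D g) & D (f \+ g) = D f \+ D g].
  exact.
rewrite {}/D; elim: s => [|i s [fs' gs' IH]]; first by split.
split; [exact: smooth_iter_partial|exact: smooth_iter_partial|].
rewrite [LHS]/= IH; exact: iter_partialD.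
Qed.

Lemma pderivZ (b : 'I_m -> nat) (c : R) f : smooth R m f ->
  pderiv b (fun x => c * f x) = fun x => c * pderiv b f x.
Proof.
rewrite /pderiv; move: (enum _) => s fs.
pose D (h : fct) : fct := foldr (fun i => iter (b i) (partial i)) h s.
suff [_] : smooth R m (D f) /\ D (fun x => c * f x) = fun x => c * D f x.
  exact.
rewrite {}/D; elim: s => [|i s [fs' IH]]; first by split.
split; first exact: smooth_iter_partial.
rewrite [LHS]/= IH; exact: iter_partialZ.
Qed.

End SmoothFunctions.

(** * Linearity of P on smooth functions, and smoothness of its values *)

Section DifferentialOperators.
Context (R : realType) (m r : nat) (P : LPDO R m r).
Local Notation fct := ('rV[R]_m -> R).
Implicit Types f g : fct.

Lemma lpdo_smooth f : smooth R m f -> smooth R m (lpdo_op P f).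
Proof.
move=> fs; apply: smooth_sum => a.
by apply: smoothM; [exact: coef_smooth|exact: smooth_pderiv].
Qed.

Lemma lpdoD f g : smooth R m f -> smooth R m g ->
  lpdo_op P (fun x => f x + g x) = fun x => lpdo_op P f x + lpdo_op P g x.
Proof.
move=> fs gs; apply/funext => x; rewrite /lpdo_op -big_split/=.
by apply: eq_bigr => a _; rewrite (pderivD _ fs gs) mulrDr.
Qed.

Lemma lpdoZ (c : R) f : smooth R m f ->
  lpdo_op P (fun x => c * f x) = fun x => c * lpdo_op P f x.
Proof.
move=> fs; apply/funext => x; rewrite /lpdo_op mulr_sumr.
by apply: eq_bigr => a _; rewrite (pderivZ _ _ fs) mulrCA.
Qed.

Lemma lpdo0 : lpdo_op P (fun=> 0) = fun=> 0.
Proof.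
have := lpdoZ 0 (@smooth_cst R m 0).
rewrite (_ : (fun x => 0 * _) = fun=> 0) => [->|];
  by apply/funext => x; rewrite mul0r.
Qed.

Lemma lpdo_sum (I : Type) (s : seq I) (c : I -> R) (F : I -> fct) :
  (forall i, smooth R m (F i)) ->
  lpdo_op P (fun x => \sum_(i <- s) c i * F i x) =
  fun x => \sum_(i <- s) c i * lpdo_op P (F i) x.
Proof.
move=> Fs; elim: s => [|i s IH].
  transitivity (lpdo_op P (fun=> 0)); last rewrite lpdo0.
    by congr lpdo_op; apply/funext => x; rewrite big_nil.
  by apply/funext => x; rewrite big_nil.
transitivity (lpdo_op P (fun x => c i * F i x + \sum_(j <- s) c j * F j x)).
  by congr lpdo_op; apply/funext => x; rewrite big_cons.
rewrite lpdoD ?IH ?lpdoZ//.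
- by apply/funext => x; rewrite big_cons.
- exact: smoothZ.
- by apply: smooth_sum => j; exact: smoothZ.
Qed.

End DifferentialOperators.

(** * Products of one-variable polynomials and their partial derivatives *)

Section SeparatedPolynomials.
Context (R : realType) (m : nat).

(** Partial derivatives act on the factors separately and stay in this class, which reduces
    interpolation in several variables to orders of roots in one variable. *)
Definition sepfun (q : 'I_m -> {poly R}) (x : 'rV[R]_m) : R :=
  \prod_l (q l).[x 0 l].

Lemma sepfun_continuous q : continuous (sepfun q).
Proof.
apply: continuous_big => [|l _ x]; first exact: mul_continuous.
apply: (continuous_comp (g := horner (q l))); first exact: coord_continuous.
exact: continuous_horner.
Qed.

Lemma sepfun_line q i x (h : R) :
  sepfun q (h *: delta_mx 0 i + x) =
  ((\prod_(l | l != i) (q l).[x 0 l])%:P * (q i \Po ('X + (x 0 i)%:P))).[h].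
Proof.
rewrite /sepfun (bigD1 i)//= mulrC hornerE horner_comp !hornerE.
congr (_ * _); last by rewrite !mxE !eqxx mulr1.
by apply: eq_bigr => l li; rewrite !mxE (negbTE li) mulr0 add0r.
Qed.

Definition dsep (i : 'I_m) (q : 'I_m -> {poly R}) : 'I_m -> {poly R} :=
  fun l => if l == i then (q l)^`() else q l.

(** Along a line in direction [i] only the [i]-th factor varies, so the restriction is a polynomial
    [p] in the parameter, and its formal derivative at 0 is the value sought. *)
Lemma sepfun_is_derive q i x :
  is_derive x (delta_mx 0 i) (sepfun q) (sepfun (dsep i q) x).
Proof.
set p := (\prod_(l | l != i) (q l).[x 0 l])%:P * (q i \Po ('X + (x 0 i)%:P)).
have lineE : (fun h : R => sepfun q (h *: delta_mx 0 i + x)) = horner p.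
  by apply/funext => h; exact: sepfun_line.
have dp : p^`().[0] = sepfun (dsep i q) x.
  rewrite /p mul_polyC derivZ deriv_comp derivD derivX derivC addr0 mulr1.
  rewrite hornerZ horner_comp !hornerE /sepfun [in RHS](bigD1 i)//=.
  rewrite /dsep eqxx mulrC.
  by congr (_ * _); apply: eq_bigr => l /negbTE ->.
apply: DeriveDef.
  by apply/derivable1P; rewrite lineE; exact: derivable_horner.
rewrite -dp -(@derive_val _ _ _ _ _ _ _ (is_derive_poly p 0)) /derive.
suff -> : (fun h : R => h^-1 *: ((sepfun q \o shift x) (h *: delta_mx 0 i) -
      sepfun q x)) =
    (fun h : R => h^-1 *: ((horner p \o shift 0) (h *: 1) - p.[0])) by [].
apply/funext => h /=; congr (_ *: (_ - _)).
  by rewrite -[h *: 1]/(h * 1) mulr1 addr0 -lineE.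
by rewrite -lineE scale0r add0r.
Qed.

Lemma partial_sepfun i q : partial i (sepfun q) = sepfun (dsep i q).
Proof.
apply/funext => x; rewrite /partial.
exact: (@derive_val _ _ _ _ _ _ _ (sepfun_is_derive q i x)).
Qed.

Lemma sepfun_smooth q : smooth R m (sepfun q).
Proof.
apply: (@smooth_coind _ _ (range sepfun)); last by exists q.
move=> _ [{}q _ <-]; split=> [|i x|i]; first exact: sepfun_continuous.
  exact: (@ex_derive _ _ _ _ _ _ _ (sepfun_is_derive q i x)).
by exists (dsep i q) => //; rewrite partial_sepfun.
Qed.

Lemma pderiv_sepfun (b : 'I_m -> nat) q :
  pderiv b (sepfun q) = sepfun (fun l => (q l)^`(b l)).
Proof.
rewrite /pderiv.
(* The induction runs over duplicate-free lists: [uniq] ensures that factor [i] is still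
   undifferentiated when its [b i] derivatives are taken. *)
suff H (s : seq 'I_m) : uniq s ->
    foldr (fun i => iter (b i) (partial i)) (sepfun q) s =
    sepfun (fun l => if l \in s then (q l)^`(b l) else q l).
  rewrite H ?enum_uniq//; congr sepfun; apply/funext => l.
  by rewrite mem_enum.
elim: s => [|i s IH]/=; first by [].
move=> /andP[nis us]; rewrite IH//.
have -> n : iter n (partial i)
      (sepfun (fun l => if l \in s then (q l)^`(b l) else q l)) =
    sepfun (fun l => if l == i then (q l)^`(n)
                     else if l \in s then (q l)^`(b l) else q l).
  elim: n => [|n IHn].
    congr sepfun; apply/funext => l.
    by case: eqVneq => // ->; rewrite (negbTE nis).
  rewrite iterS IHn partial_sepfun; congr sepfun; apply/funext => l.
  by rewrite /dsep; case: eqVneq => // _; rewrite -derivnS.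
congr sepfun; apply/funext => l; rewrite inE.
by case: eqVneq => // ->.
Qed.

End SeparatedPolynomials.

(** * Derivatives at [c] of a polynomial divisible by a power of ['X - c%:P] *)

Section RootMultiplicity.
Context (R : comNzRingType).
Implicit Types s : {poly R}.

(** Each derivative takes one factor off the power. The Leibniz term that differentiates the
    cofactor keeps a factor vanishing at [c], so the value of [t] at [c] only picks up n, n - 1, and
    so on. *)
Lemma derivn_XsubC_exp (c : R) n s k : (k <= n)%N ->
  exists2 t, (('X - c%:P) ^+ n * s)^`(k) = ('X - c%:P) ^+ (n - k) * t &
             t.[c] = (n ^_ k)%:R * s.[c].
Proof.
elim: k => [_|k IH kn].
  by exists s; rewrite ?subn0 ?derivn0// ffactn0 mul1r.
have [t Et tc] := IH (ltnW kn).
exists (t *+ (n - k) + ('X - c%:P) * t^`()); last first.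
  rewrite hornerD hornerMn hornerM hornerXsubC subrr mul0r addr0 tc.
  by rewrite ffactnSr natrM -mulr_natr mulrAC.
rewrite derivnS Et derivM.
have -> : (n - k = (n - k.+1).+1)%N by rewrite -subSn.
rewrite deriv_exp derivXsubC mul1r /= mulrDr exprS.
by rewrite mulrnAr mulrnAl -mulrA mulrCA.
Qed.

Lemma horner_derivn_XsubC_lt (c : R) n s k : (k < n)%N ->
  (('X - c%:P) ^+ n * s)^`(k).[c] = 0.
Proof.
move=> kn; have [t -> _] := derivn_XsubC_exp c s (ltnW kn).
have -> : (n - k = (n - k.+1).+1)%N by rewrite -subSn.
by rewrite exprS !hornerM hornerXsubC subrr !mul0r.
Qed.

Lemma horner_derivn_XsubC (c : R) n s :
  (('X - c%:P) ^+ n * s)^`(n).[c] = n`!%:R * s.[c].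
Proof.
have [t -> tc] := derivn_XsubC_exp c s (leqnn n).
by rewrite subnn expr0 mul1r tc ffactnn.
Qed.

End RootMultiplicity.

(** * Subspaces of every finite dimension in the image of P *)

Section ImageDimension.
Context (R : realType) (m r : nat) (P : LPDO R m r).

Lemma finsupp_coef_neq0 (x : 'rV[R]_m) : finsupp P x ->
  exists a y, coef P a y != 0.
Proof.
move=> [a [b Pab]]; exists a; apply: contrapT => Pa0.
(* The zero function is written as a multiple by 0 so that [pderivZ] makes all its derivatives
   vanish. *)
have a0 : coef P a = fun y => 0 * cst 0 y.
  apply/funext => y; rewrite mul0r; apply/eqP.
  by apply: contrapT => /negP ay; apply: Pa0; exists y.
by move: Pab; rewrite a0 pderivZ ?mul0r ?eqxx//; exact: smooth_cst.
Qed.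

(* A segment in direction [i0] around a point where a coefficient is nonzero
   provides any finite number of points with distinct [i0]-coordinates. *)
Lemma coef_neq0_points (i0 : 'I_m) a (x0 : 'rV[R]_m) : coef P a x0 != 0 ->
  exists p : nat -> 'rV[R]_m,
    injective (fun j => p j 0 i0) /\ forall j, coef P a (p j) != 0.
Proof.
move=> Pa0.
pose line (t : R) := t *: delta_mx 0 i0 + x0 : 'rV[R]_m.
have cl : {for 0, continuous (coef P a \o line)}.
  apply: continuous_comp; last exact: smooth_continuous (coef_smooth P a) _.
  by apply: cvgD; [exact: scalel_continuous|exact: cvg_cst].
have : \forall t \near (0 : R), coef P a (line t) != 0.
  apply: (cl [set y : R | y != 0]); apply: open_nbhs_nbhs.
  by split; [exact: open_neq|rewrite /= /line scale0r add0r].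
move=> /nbhs_ballP[e /= e0 eP].
(* The denominator exceeds 1, which keeps every parameter strictly inside the ball of radius [e]. *)
exists (fun j => line (e / j.+2%:R)); split=> [j k|j].
  rewrite /line !mxE !eqxx !mulr1 => /addIr /(mulfI (lt0r_neq0 e0)) /invr_inj.
  by move=> /eqP; rewrite eqr_nat => /eqP[].
apply: eP; rewrite /ball /= sub0r normrN gtr0_norm ?divr_gt0//.
by rewrite ltr_pdivrMr// ltr_pMr// ltr1n.
Qed.

(* Hermite interpolation: the separated polynomial vanishes to order > r at
   the other points, and its lowest-order term at [p j] is the monomial of a
   multi-index of maximal order among those with a nonzero coefficient. *)
Lemma lpdo_interpolation (i0 : 'I_m) (n : nat) (p : 'I_n -> 'rV[R]_m) j :
  injective (fun i => p i 0 i0) -> (exists a, coef P a (p j) != 0) ->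
  exists f, [/\ smooth R m f, lpdo_op P f (p j) != 0 &
                forall i, i != j -> lpdo_op P f (p i) = 0].
Proof.
move=> pinj [a0 Pa0].
pose ord (a : midx m r) := (\sum_l val a l)%N.
case: (@arg_maxnP _ a0 (fun a => coef P a (p j) != 0) ord Pa0) => a Pa amax.
(* Coordinate [i0] tells the points apart, so this factor alone carries the zeros at the other
   points; [r.+1] exceeds every entry of a multi-index of order at most [r]. *)
pose s l : {poly R} :=
  if l == i0 then \prod_(i | i != j) ('X - (p i 0 i0)%:P) ^+ r.+1 else 1.
pose q l := ('X - (p j 0 l)%:P) ^+ (midx_fun a l) * s l.
exists (sepfun q); split; first exact: sepfun_smooth.
- rewrite /lpdo_op (bigD1 a)//= big1 ?addr0 => [|b ba]; last first.
    have [->|Pb] := eqVneq (coef P b (p j)) 0; first by rewrite mul0r.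
    (* If [b] dominated [a] in every entry, then, being different, it would have larger order,
       against the maximality of [a]. At a smaller entry the derivative still has a root at
       [p j]. *)
    have [l bl] : exists l, (midx_fun b l < midx_fun a l)%N.
      apply: contrapT => nlt.
      have ab l : (midx_fun a l <= midx_fun b l)%N.
        by rewrite leqNgt; apply/negP => lt; apply: nlt; exists l.
      move: ba; apply/negP; rewrite negbK; apply/eqP/val_inj/ffunP => l.
      apply/val_inj/eqP; rewrite eqn_leq [X in _ && X]ab andbT leqNgt.
      apply/negP => lt; have : (ord b <= ord a)%N := amax b Pb.
      rewrite leqNgt => /negP; apply; rewrite /ord.
      rewrite (bigD1 l)// [X in (_ < X)%N](bigD1 l)//=.
      by rewrite -addSn leq_add// leq_sum// => k _; exact: ab.
    rewrite pderiv_sepfun /sepfun (bigD1 l)//=.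
    by rewrite horner_derivn_XsubC_lt// mul0r mulr0.
  (* In the term of [a] each factor is a factorial times the value of [s l], which is nonzero
     because the other points have other [i0]-coordinates. *)
  rewrite mulf_neq0// pderiv_sepfun /sepfun; apply/prodf_neq0 => l _.
  rewrite horner_derivn_XsubC; apply: mulf_neq0.
    by rewrite pnatr_eq0 -lt0n fact_gt0.
  rewrite /s; have [->|_] := eqVneq l i0; last by rewrite hornerC oner_neq0.
  rewrite horner_prod; apply/prodf_neq0 => i ij.
  rewrite horner_exp hornerXsubC expf_neq0// subr_eq0.
  by apply: contraNneq ij => /pinj ->.
- move=> i ij; rewrite /lpdo_op big1// => b _.
  have [t qE] : exists t, q i0 = ('X - (p i 0 i0)%:P) ^+ r.+1 * t.
    by rewrite /q /s eqxx (bigD1 i)//= mulrCA; eexists.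
  rewrite pderiv_sepfun /sepfun (bigD1 i0)//= qE.
  by rewrite horner_derivn_XsubC_lt ?ltn_ord// mul0r mulr0.
Qed.

(** The values of the interpolants' images at the points form a diagonal matrix with nonzero
    diagonal, so evaluating at [p j] isolates [c j]. *)
Lemma lpdo_image_dim (i0 : 'I_m) (x : 'rV[R]_m) (n : nat) : finsupp P x ->
  exists F : 'I_n -> 'rV[R]_m -> R, (forall j, smooth R m (F j)) /\
    forall c : 'I_n -> R, (forall y, \sum_j c j * lpdo_op P (F j) y = 0) ->
      forall j, c j = 0.
Proof.
move=> /finsupp_coef_neq0[a [y /(coef_neq0_points i0)[p [pinj Pp]]]].
have pinj' : injective (fun i : 'I_n => p i 0 i0).
  by move=> i j /pinj/val_inj.
have /choice[F FP] (j : 'I_n) : exists f,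
    [/\ smooth R m f, lpdo_op P f (p j) != 0 &
    forall i : 'I_n, i != j -> lpdo_op P f (p i) = 0].
  by apply: (lpdo_interpolation pinj'); exists a.
exists F; split=> [j|c c0 j]; first by have [] := FP j.
have := c0 (p j); rewrite (bigD1 j)//= big1 ?addr0.
  move=> /eqP; rewrite mulf_eq0; have [_ /negbTE -> _] := FP j.
  by rewrite orbF => /eqP.
by move=> i ij; have [_ _ ->] := FP i; rewrite ?mulr0// eq_sym.
Qed.

Lemma lpdo_image_subspace (i0 : 'I_m) (x : 'rV[R]_m) (n : nat) : finsupp P x ->
  exists2 E, subspace_of_dim n E & E `<=` lpdo_op P @` smooth R m.
Proof.
move=> /(lpdo_image_dim i0 n)[F [Fs Fi]].
exists [set f | exists c : 'I_n -> R,
    f = fun y => \sum_j c j * lpdo_op P (F j) y].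
  by exists (fun j => lpdo_op P (F j)); split.
move=> _ [c ->]; exists (fun y => \sum_j c j * F j y); last exact: lpdo_sum.
by apply: smooth_sum => j; exact: smoothZ.
Qed.

End ImageDimension.

(** * Levels, Kuratowski pairs and graphs inside a superstructure *)

Section SuperstructureCoding.
Context (X : Type) (V : superstructure X).
Implicit Types a b c : V.
Local Notation level := (ss_level ss_mem (ss_atom V)).

(** Exactly the condition under which [mkset] is specified. *)
Definition bounded (A : set V) := exists n, A `<=` level n.

Lemma mksetP (A : set V) : bounded A ->
  ~ range (ss_atom V) (mkset A) /\ forall c, ss_mem c (mkset A) <-> A c.
Proof. by move=> bA; rewrite /mkset; case: cid => b /= /(_ bA). Qed.

Lemma mem_mkset (A : set V) c : bounded A -> ss_mem c (mkset A) <-> A c.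
Proof. by move=> /mksetP[]. Qed.

Lemma level_le n k : (n <= k)%N -> level n `<=` level k.
Proof.
move=> /subnK <-; elim: (k - n)%N => [|j IH] a na; first exact: na.
by left; exact: IH.
Qed.

Lemma bounded_level n (A : set V) : A `<=` level n -> bounded A.
Proof. by exists n. Qed.

Lemma level_mkset n (A : set V) : A `<=` level n -> level n.+1 (mkset A).
Proof.
move=> An; have [nA AP] := mksetP (bounded_level An).
by right; split=> // b /AP/An.
Qed.

Lemma bounded1 a : bounded [set a].
Proof. by have [n an] := ss_rank a; exists n => _ ->. Qed.

Lemma bounded2 a b : bounded [set a; b].
Proof.
have [n an] := ss_rank a; have [k bk] := ss_rank b; exists (maxn n k).
move=> _ [->|->].
  exact: (level_le (leq_maxl n k)).
exact: (level_le (leq_maxr n k)).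
Qed.

Lemma mem_set1 c a : ss_mem c (mkset [set a]) <-> c = a.
Proof. exact: mem_mkset (bounded1 a). Qed.

Lemma mem_set2 c a b : ss_mem c (mkset [set a; b]) <-> c = a \/ c = b.
Proof. exact: mem_mkset (bounded2 a b). Qed.

Lemma mem_opair c a b : ss_mem c (opair a b) <->
  c = mkset [set a] \/ c = mkset [set a; b].
Proof. exact: mem_set2. Qed.

Lemma set1_inj a b : mkset [set a] = mkset [set b] -> a = b.
Proof. by move=> ab; apply/mem_set1; rewrite -ab; exact/mem_set1. Qed.

Lemma opair_inj a b c d : opair a b = opair c d -> a = c /\ b = d.
Proof.
move=> E.
have ac : a = c.
  have : ss_mem (mkset [set a]) (opair c d).
    by rewrite -E; apply/mem_opair; left.
  move=> /mem_opair[/set1_inj//|E1].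
  by apply/esym/mem_set1; rewrite E1; apply/mem_set2; left.
split=> //; subst c.
have : ss_mem (mkset [set a; b]) (opair a d).
  by rewrite -E; apply/mem_opair; right.
have : ss_mem (mkset [set a; d]) (opair a b).
  by rewrite E; apply/mem_opair; right.
have b2 : ss_mem b (mkset [set a; b]) by apply/mem_set2; right.
have d2 : ss_mem d (mkset [set a; d]) by apply/mem_set2; right.
move=> /mem_opair dE /mem_opair bE.
have bE' : b = a \/ b = d.
  by case: bE b2 => -> => [/mem_set1|/mem_set2]; [left|].
have dE' : d = a \/ d = b.
  by case: dE d2 => -> => [/mem_set1|/mem_set2]; [left|].
(* In the degenerate case [b = a], the element [d] is [a] or [b], which are the same. *)
by case: bE' => // ba; case: dE' => // ->.
Qed.

Lemma mem_notin_atoms a c : ss_mem c a -> ~ range (ss_atom V) a.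
Proof. by move=> ca [x _ xa]; apply: (@ss_mem_atom _ V c x); rewrite xa. Qed.

Lemma mkset_eqP (A : set V) a : bounded A -> ~ range (ss_atom V) a ->
  (forall c, ss_mem c a <-> A c) -> a = mkset A.
Proof.
move=> bA na aP; have [nA AP] := mksetP bA.
by apply: ss_ext => // c; rewrite aP AP.
Qed.

(** Here and in the next two lemmas the left-hand side is the meaning of a bounded formula defined
    below. The set described has an element, hence is no atom, and extensionality applies. *)
Lemma set1_eqP u a :
  (ss_mem a u /\ forall z, ss_mem z u -> z = a) <-> u = mkset [set a].
Proof.
split=> [[au uP]|->]; last by split=> [|z /mem_set1//]; apply/mem_set1.
apply: mkset_eqP => [||c]; [exact: bounded1|exact: mem_notin_atoms au|].
by split=> [/uP|->].
Qed.

Lemma set2_eqP u a b :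
  (ss_mem a u /\ ss_mem b u /\ forall z, ss_mem z u -> z = a \/ z = b) <->
  u = mkset [set a; b].
Proof.
split=> [[au [bu uP]]|->].
  apply: mkset_eqP => [||c]; [exact: bounded2|exact: mem_notin_atoms au|].
  by split=> [/uP|[->|->]].
by split; [|split=> [|z /mem_set2//]]; apply/mem_set2; [left|right].
Qed.

Lemma pair_eqP p a b :
  (exists u, ss_mem u p /\ exists v, ss_mem v p /\
    ((ss_mem a u /\ forall z, ss_mem z u -> z = a) /\
     (ss_mem a v /\ ss_mem b v /\ forall z, ss_mem z v -> z = a \/ z = b) /\
     forall w, ss_mem w p -> w = u \/ w = v)) <-> p = opair a b.
Proof.
split=> [[u [up [v [vp [/set1_eqP uE [/set2_eqP vE wP]]]]]]|/set2_eqP].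
  by apply/set2_eqP; rewrite -uE -vE.
move=> [up [vp wP]]; exists (mkset [set a]); split=> //.
exists (mkset [set a; b]); split=> //.
by split; [exact/set1_eqP|split; [exact/set2_eqP|]].
Qed.

Lemma level_opair n a b : level n a -> level n b -> level n.+2 (opair a b).
Proof.
move=> an bn; apply: level_mkset => _ [->|->]; apply: level_mkset.
  by move=> _ ->.
by move=> _ [->|->].
Qed.

Section Graph.
Context (A B : Type) (cA : A -> V) (cB : B -> V) (D : set A) (f : A -> B).
Context (n : nat).
Context (cAn : forall x, level n (cA x)) (cBn : forall y, level n (cB y)).

Lemma graph_bounded : [set opair (cA x) (cB (f x)) | x in D] `<=` level n.+2.
Proof. by move=> _ [x _ <-]; exact: level_opair. Qed.

Lemma level_graph : level n.+3 (graph cA cB D f).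
Proof. exact: level_mkset graph_bounded. Qed.

Lemma mem_graph a b : ss_mem (opair a b) (graph cA cB D f) <->
  exists x, [/\ D x, a = cA x & b = cB (f x)].
Proof.
rewrite /graph (mem_mkset _ (bounded_level graph_bounded)).
split=> [[x Dx /opair_inj[<- <-]]|[x [Dx -> ->]]]; first by exists x.
by exists x.
Qed.

End Graph.

Lemma graph_inj (A B : Type) (cA : A -> V) (cB : B -> V) n (f g : A -> B) :
  (forall x, level n (cA x)) -> (forall y, level n (cB y)) ->
  injective cA -> injective cB ->
  graph cA cB setT f = graph cA cB setT g -> f = g.
Proof.
move=> cAn cBn cAI cBI fg; apply/funext => x.
have : ss_mem (opair (cA x) (cB (f x))) (graph cA cB setT g).
  by rewrite -fg; apply/(mem_graph _ _ cAn cBn); exists x.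
by move=> /(mem_graph _ _ cAn cBn)[y [_ /cAI -> /cBI]].
Qed.

Definition functional (F : V) := forall a b b' : V,
  ss_mem (opair a b) F -> ss_mem (opair a b') F -> b = b'.

(** [app] chooses some related value; single-valuedness turns the choice into evaluation. *)
Lemma app_eq F a b : functional F -> ss_mem (opair a b) F -> app F a = b.
Proof.
move=> Ff ab; rewrite /app; case: cid => c /= /(_ (ex_intro _ b ab)) /Ff.
exact.
Qed.

End SuperstructureCoding.

(** * Bounded formulas for pairs and for membership of pairs in a relation *)

Section Formulas.

(* The bound variables of these formulas have indices below 8, so that [sat]
   computes when the free ones are of the form [n.+4.+4]. *)
Definition fm_set1 (u a : nat) := FAnd (FMem a u) (FAll 3 u (FEq 3 a)).

Definition fm_set2 (v a b : nat) := FAnd (FMem a v)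
  (FAnd (FMem b v) (FAll 3 v (FOr (FEq 3 a) (FEq 3 b)))).

Definition fm_pair (p a b : nat) := FEx 0 p (FEx 1 p
  (FAnd (fm_set1 0 a) (FAnd (fm_set2 1 a b)
    (FAll 2 p (FOr (FEq 2 0) (FEq 2 1)))))).

Definition fm_rel (F a b : nat) := FEx 4 F (fm_pair 4 a b).

(** Variable 5 is the outer pair, 6 one of its elements and 7 the inner pair: descending through
    Kuratowski components keeps every quantifier bounded. *)
Definition fm_rel2 (F a b c : nat) := FEx 5 F (FEx 6 5 (FEx 7 6
  (FAnd (fm_pair 7 a b) (fm_pair 5 7 c)))).

Context (X : Type) (V : superstructure X).
Implicit Types e : nat -> V.

Lemma sat_pair e p a b :
  sat e (fm_pair p.+4 a.+4 b.+4) <-> e p.+4 = opair (e a.+4) (e b.+4).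
Proof. exact: (pair_eqP (e p.+4) (e a.+4) (e b.+4)). Qed.

Lemma sat_rel e F a b : sat e (fm_rel F.+4.+1 a.+4.+1 b.+4.+1) <->
  ss_mem (opair (e a.+4.+1) (e b.+4.+1)) (e F.+4.+1).
Proof.
split=> [[q [qF /sat_pair qE]]|qF]; first by rewrite -[X in ss_mem X]qE.
by exists (opair (e a.+4.+1) (e b.+4.+1)); split=> //; apply/sat_pair.
Qed.

Lemma sat_rel2 e F a b c : sat e (fm_rel2 F.+4.+4 a.+4.+4 b.+4.+4 c.+4.+4) <->
  ss_mem (opair (opair (e a.+4.+4) (e b.+4.+4)) (e c.+4.+4)) (e F.+4.+4).
Proof.
split=> [[q [qF [u [uq [p [pu [/sat_pair pE /sat_pair qE]]]]]]]|qF].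
  by rewrite -[X in opair X _]pE -[X in ss_mem X]qE.
set p := opair (e a.+4.+4) (e b.+4.+4).
exists (opair p (e c.+4.+4)); split; first exact: qF.
exists (mkset [set p]); split; first by apply/mem_opair; left.
exists p; split; first exact/mem_set1.
by split; apply/sat_pair.
Qed.

End Formulas.

(** * Transfer of pairs, membership and single-valuedness *)

Section Transfer.
Context (X Y : Type) (V : superstructure X) (W : superstructure Y).
Context (star : nonstandard_extension V W).

(* Assigns the elements of [s] to the variables [8, 9, ...]. *)
Definition env (Z : Type) (z : Z) (s : seq Z) : nat -> Z :=
  fun k => nth z s (k - 8).

Lemma star_opair a b : star (opair a b) = opair (star a) (star b).
Proof.
suff /(star_transfer star)/sat_pair :
  sat (env a [:: opair a b; a; b]) (fm_pair 8 9 10) by [].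
exact/sat_pair.
Qed.

Lemma star_mem a b : ss_mem a b -> ss_mem (star a) (star b).
Proof.
by move=> ab; exact: (star_transfer star (FMem 8 9) (env a [:: a; b])).1 ab.
Qed.

Lemma star_functional F : functional F -> functional (star F).
Proof.
move=> Ff.
(* [functional] quantifies over the whole universe, so the entries are reached through [F] instead:
   10 and 14 are pairs, 11 and 15 elements of these, and 12, 13, 16 the entries. *)
have H : sat (env F [:: F]) (FAll 10 8 (FAll 11 10 (FAll 12 11 (FAll 13 11
    (FAll 14 8 (FAll 15 14 (FAll 16 15
      (FImp (fm_pair 10 12 13) (FImp (fm_pair 14 12 16) (FEq 13 16)))))))))).
  move=> q qF u uq a au b bu q' q'F u' u'q' b' b'u'.
  move=> /sat_pair qE /sat_pair q'E.
  apply: (Ff a); first by rewrite -[X in ss_mem X]qE.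
  by rewrite -[X in ss_mem X]q'E.
move=> a b b' ab ab'; have := (star_transfer star _ _).1 H.
(* The component [{c, d}] of a pair contains both entries and thus serves as the bound for each of
   them. *)
have aP (c d : W) : ss_mem (mkset [set c; d]) (opair c d).
  by apply/mem_opair; right.
have aL (c d : W) : ss_mem c (mkset [set c; d]) by apply/mem_set2; left.
have aR (c d : W) : ss_mem d (mkset [set c; d]) by apply/mem_set2; right.
move=> /(_ _ ab _ (aP a b) _ (aL a b) _ (aR a b) _ ab' _ (aP a b') _ (aR a b')).
by apply; apply/sat_pair.
Qed.

End Transfer.

(** * Codes of reals, functions and operations: levels, injectivity, membership *)

Section CodedOperations.
Context (R : realType) (X : Type) (io : R -> X) (io_inj : injective io).
Context (V : superstructure X) (m : nat).
Local Notation fct := ('rV[R]_m -> R).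
Local Notation level := (ss_level ss_mem (ss_atom V)).
Local Notation cfun := (@code_fun R X io V m).

Lemma code_real_inj : injective (code_real io V).
Proof. by move=> s t st; apply: io_inj; exact: ss_atom_inj st. Qed.

Lemma level_code_real n t : level n (code_real io V t).
Proof. by apply: (level_le (leq0n n)); exists (io t). Qed.

Lemma level_code_point (x : 'rV[R]_m) : level 3 (code_point io V x).
Proof. by apply: level_graph => ?; exact: level_code_real. Qed.

Lemma code_point_inj : injective (@code_point R X io V m).
Proof.
move=> x y xy; apply/rowP => i.
have : (fun i => x 0 i) = (fun i => y 0 i); last by move=> /(congr1 (@^~ i)).
apply: (graph_inj (n := 0) _ _ _ _ xy); try by move=> ?; exact: level_code_real.
  by move=> j k /code_real_inj /eqP; rewrite eqr_nat => /eqP /val_inj.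
exact: code_real_inj.
Qed.

(** A graph lies three levels above its arguments and values: atoms at 0, points at 3, functions at
    6. Later bounds 8 and 9 add two for a pair, and one more for a set of functions. *)
Lemma level_code_fun n (f : fct) : (6 <= n)%N -> level n (cfun f).
Proof.
move=> n6; apply: (level_le n6); apply: (@level_graph _ _ _ _ _ _ _ _ 3) => ?.
  exact: level_code_point.
exact: level_code_real.
Qed.

Lemma code_fun_inj : injective cfun.
Proof.
move=> f g; apply: (graph_inj (n := 3)) => [?|?||].
- exact: level_code_point.
- exact: level_code_real.
- exact: code_point_inj.
- exact: code_real_inj.
Qed.

Lemma mem_reals a : ss_mem a (reals_ io V) <-> exists t, a = code_real io V t.
Proof.
rewrite /reals_ mem_mkset; first by split=> [[t _ <-]|[t ->]]; exists t.
by exists 0%N => _ [t _ <-]; exact: level_code_real.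
Qed.

Lemma mem_nats a : ss_mem a (nats_ io V) <-> exists n, a = code_nat io V n.
Proof.
rewrite /nats_ mem_mkset; first by split=> [[n _ <-]|[n ->]]; exists n.
by exists 0%N => _ [n _ <-]; exact: level_code_real.
Qed.

Lemma mem_code_funs (E : set fct) a :
  ss_mem a (mkset (cfun @` E)) <-> exists f, E f /\ a = cfun f.
Proof.
rewrite mem_mkset; first by split=> [[f Ef <-]|[f [Ef ->]]]; exists f.
by exists 6%N => _ [f _ <-]; exact: level_code_fun.
Qed.

Lemma mem_smooth a :
  ss_mem a (smooth_ io V m) <-> exists f, smooth R m f /\ a = cfun f.
Proof. exact: mem_code_funs. Qed.

Lemma mem_add a b : ss_mem (opair a b) (add_ io V m) <->
  exists f g, [/\ smooth R m f, smooth R m g, a = opair (cfun f) (cfun g) &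
                  b = cfun (fun x => f x + g x)].
Proof.
rewrite (@mem_graph _ _ _ _ _ _ _ _ 8) => [|p|f].
- split=> [[[f g] [[fs gs] -> ->]]|[f [g [fs gs -> ->]]]]; first by exists f, g.
  by exists (f, g).
- by apply: level_opair; exact: level_code_fun.
- exact: level_code_fun.
Qed.

Lemma add_functional : functional (add_ io V m).
Proof.
move=> a b b' /mem_add[f [g [_ _ -> ->]]] /mem_add[f' [g' [_ _ + ->]]].
by move=> /opair_inj[/code_fun_inj -> /code_fun_inj ->].
Qed.

Lemma mem_scale a b : ss_mem (opair a b) (scale_ io V m) <->
  exists c f, [/\ smooth R m f, a = opair (code_real io V c) (cfun f) &
                  b = cfun (fun x => c * f x)].
Proof.
rewrite (@mem_graph _ _ _ _ _ _ _ _ 8) => [|p|f].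
- split=> [[[c f] [[_ fs] -> ->]]|[c [f [fs -> ->]]]]; first by exists c, f.
  by exists (c, f).
- by apply: level_opair; [exact: level_code_real|exact: level_code_fun].
- exact: level_code_fun.
Qed.

Lemma scale_functional : functional (scale_ io V m).
Proof.
move=> a b b' /mem_scale[c [f [_ -> ->]]] /mem_scale[c' [f' [_ + ->]]].
by move=> /opair_inj[/code_real_inj -> /code_fun_inj ->].
Qed.

Lemma mem_lpdo r (P : LPDO R m r) a b : ss_mem (opair a b) (lpdo_ io V P) <->
  exists f, [/\ smooth R m f, a = cfun f & b = cfun (lpdo_op P f)].
Proof.
by rewrite (@mem_graph _ _ _ _ _ _ _ _ 6) => // f; exact: level_code_fun.
Qed.

Lemma lpdo_functional r (P : LPDO R m r) : functional (lpdo_ io V P).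
Proof.
move=> a b b' /mem_lpdo[f [_ -> ->]] /mem_lpdo[g [_ + ->]].
by move=> /code_fun_inj ->.
Qed.

Lemma mem_findim n (E : set fct) : E `<=` smooth R m -> subspace_of_dim n E ->
  ss_mem (opair (code_nat io V n) (mkset (cfun @` E))) (findim_ io V m).
Proof.
move=> Es En; apply/mem_mkset; last by exists n, E.
exists 9%N => _ [k [F [_ _ ->]]]; apply: level_opair.
  exact: level_code_real.
by apply: level_mkset => _ [f _ <-]; exact: level_code_fun.
Qed.

End CodedOperations.

(** * The image of the extended operator and its subspace properties *)

Section StarImage.
Context (R : realType) (X : Type) (io : R -> X) (io_inj : injective io).
Context (V : superstructure X) (Y : Type) (W : superstructure Y).
Context (star : nonstandard_extension V W) (m r : nat) (P : LPDO R m r).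
Local Notation S := (smooth_ io V m).
Local Notation L := (lpdo_ io V P).

(** Phrased with the graph of the extended operator rather than [app], so that membership is a
    bounded formula open to transfer. *)
Definition star_image : set W :=
  [set g | ss_mem g (star S) /\
           exists2 f, ss_mem f (star S) & ss_mem (opair f g) (star L)].

Lemma star_image0 : star_image (star (code_fun io V (fun _ : 'rV[R]_m => 0))).
Proof.
set z := code_fun _ _ _.
have zS : ss_mem z S.
  by apply/mem_smooth; exists (fun=> 0); split=> //; exact: (@smooth_cst R m 0).
split; first exact: star_mem; exists (star z); first exact: star_mem.
rewrite -star_opair; apply/star_mem/mem_lpdo; exists (fun=> 0).
by split; [exact: (@smooth_cst R m 0)| |rewrite lpdo0].
Qed.

Lemma star_imageD f g : star_image f -> star_image g ->
  star_image (app (star (add_ io V m)) (opair f g)).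
Proof.
(* Closure under sums follows from linearity of P by transfer. Here 13 and 14 are preimages of 11
   and 12, while 15 is the sum of 11 and 12, and 16 a preimage of 15. *)
have : sat (env S [:: S; add_ io V m; L])
  (FAll 11 8 (FAll 12 8 (FAll 13 8 (FAll 14 8
    (FImp (fm_rel 10 13 11) (FImp (fm_rel 10 14 12)
      (FEx 15 8 (FAnd (fm_rel2 9 11 12 15)
        (FEx 16 8 (fm_rel 10 16 15)))))))))).
  move=> a _ b _ c _ d _ /sat_rel /mem_lpdo[f1 [f1s _ aE]].
  move=> /sat_rel /mem_lpdo[g1 [g1s _ bE]].
  exists (code_fun io V (fun x => lpdo_op P f1 x + lpdo_op P g1 x)); split.
    apply/mem_smooth; exists (fun x => lpdo_op P f1 x + lpdo_op P g1 x).
    by split; first exact: smoothD (lpdo_smooth P f1s) (lpdo_smooth P g1s).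
  split.
    apply/sat_rel2; apply/mem_add; exists (lpdo_op P f1), (lpdo_op P g1).
    split; [exact: lpdo_smooth|exact: lpdo_smooth| |by []].
    by congr (opair _ _); [exact: aE|exact: bE].
  exists (code_fun io V (fun x => f1 x + g1 x)); split.
    apply/mem_smooth; exists (fun x => f1 x + g1 x).
    by split; first exact: smoothD f1s g1s.
  apply/sat_rel; apply/mem_lpdo; exists (fun x => f1 x + g1 x).
  by split; [exact: smoothD f1s g1s| |rewrite lpdoD].
move=> /(star_transfer star _ _).1 H [fS [f1 f1S ff1]] [gS [g1 g1S gg1]].
have [] := H f fS g gS f1 f1S g1 g1S.
- exact/sat_rel.
- exact/sat_rel.
move=> h [hS [/sat_rel2 fgh [h1 [h1S]]]].
move=> /sat_rel hh1.
(* Single-valuedness of the extended addition identifies [app] with the [h] found by transfer. *)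
rewrite (app_eq (star_functional (@add_functional _ _ _ io_inj V m)) fgh).
by split=> //; exists h1.
Qed.

Lemma star_imageZ c f : ss_mem c (star (reals_ io V)) -> star_image f ->
  star_image (app (star (scale_ io V m)) (opair c f)).
Proof.
(* With the set of reals as parameter 11, the transferred scalar 12 ranges over all of
   [star (reals_ io V)], not only over images of standard reals. *)
have : sat (env S [:: S; scale_ io V m; L; reals_ io V])
  (FAll 12 11 (FAll 13 8 (FAll 14 8 (FImp (fm_rel 10 14 13)
    (FEx 15 8 (FAnd (fm_rel2 9 12 13 15)
      (FEx 16 8 (fm_rel 10 16 15)))))))).
  move=> a /mem_reals[t aE] b _ d _.
  move=> /sat_rel /mem_lpdo[f1 [f1s _ bE]].
  exists (code_fun io V (fun x => t * lpdo_op P f1 x)); split.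
    apply/mem_smooth; exists (fun x => t * lpdo_op P f1 x).
    by split; first exact: smoothZ (lpdo_smooth P f1s).
  split.
    apply/sat_rel2; apply/mem_scale; exists t, (lpdo_op P f1).
    split; [exact: lpdo_smooth| |by []].
    by congr (opair _ _); [exact: aE|exact: bE].
  exists (code_fun io V (fun x => t * f1 x)); split.
    apply/mem_smooth; exists (fun x => t * f1 x).
    by split; first exact: smoothZ f1s.
  apply/sat_rel; apply/mem_lpdo; exists (fun x => t * f1 x).
  by split; [exact: smoothZ f1s| |rewrite lpdoZ].
move=> /(star_transfer star _ _).1 H cR [fS [f1 f1S ff1]].
have [] := H c cR f fS f1 f1S; first exact/sat_rel.
move=> h [hS [/sat_rel2 cfh [h1 [h1S]]]].
move=> /sat_rel hh1.
rewrite (app_eq (star_functional (@scale_functional _ _ _ io_inj V m)) cfh).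
by split=> //; exists h1.
Qed.

Lemma star_image_subspace : star_subspace io star m star_image.
Proof.
split; first by move=> f [].
- exact: star_image0.
- exact: star_imageD.
- exact: star_imageZ.
Qed.

Lemma star_image_infinite_dim (i0 : 'I_m) x : finsupp P x ->
  star_infinite_dim io star m star_image.
Proof.
move=> Px.
(* The dimension 12 ranges over [nats_], so transfer covers nonstandard [N] too. The space 15 is
   reached through the pair 13 in [findim_]; its elements 16 have preimages 17. *)
have : sat (env S [:: S; L; nats_ io V; findim_ io V m])
  (FAll 12 10 (FEx 13 11 (FEx 14 13 (FEx 15 14 (FAnd (fm_pair 13 12 15)
    (FAll 16 15 (FAnd (FMem 16 8) (FEx 17 8 (fm_rel 9 17 16))))))))).
  move=> a /mem_nats[n aE].
  have [E En EP] := lpdo_image_subspace i0 n Px.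
  set cE := mkset (@code_fun R X io V m @` E).
  exists (opair a cE); split.
    rewrite [a]aE; apply: mem_findim => // f /EP[g gs <-]; exact: lpdo_smooth.
  exists (mkset [set a; cE]); split; first by apply/mem_opair; right.
  exists cE; split; first by apply/mem_set2; right.
  split; first exact/sat_pair.
  move=> b /mem_code_funs[_ [/EP[g gs <-] bE]]; split.
    apply/mem_smooth; exists (lpdo_op P g); split; last exact: bE.
    exact: lpdo_smooth.
  exists (code_fun io V g); split; first by apply/mem_smooth; exists g.
  by apply/sat_rel; apply/mem_lpdo; exists g.
move=> /(star_transfer star _ _).1 H N /H[q [qF [u [uq [E [Eu]]]]]].
move=> [/sat_pair qE EP]; exists E; split.
  by rewrite -[X in ss_mem X]qE.
move=> g /EP[gS [f [fS /sat_rel fg]]].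
by split=> //; exists f.
Qed.

End StarImage.

Theorem corollary5p4 (R : realType) (X : Type) (io : R -> X)
  (io_inj : injective io) (V : superstructure X)
  (Y : Type) (W : superstructure Y) (star : nonstandard_extension V W)
  (star_sat : polysaturated star)
  (m r : nat) (m_ge1 : (1 <= m)%N) (P : LPDO R m r)
  (P_finsupp : finsupp P = [set: 'rV[R]_m]) :
  exists I : set W,
    [/\ star_subspace io star m I,
        star_infinite_dim io star m I &
        forall g : W, I g ->
          exists f : W, ss_mem f (star (smooth_ io V m)) /\
            forall (x : 'rV[R]_m) (k : nat),
              star_jet io star k x (star_lpdo io star P f) =
              star_jet io star k x g].
Proof.
exists (star_image io star P); split.
- exact: star_image_subspace.
(* The base point is 0, and [m_ge1] supplies the coordinate direction along which points are
   separated. *)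
- by apply: (@star_image_infinite_dim _ _ _ _ _ _ _ _ _ _ (Ordinal m_ge1) 0);
    rewrite P_finsupp.
- move=> g [_ [f fS fg]]; exists f; split=> // x k; congr star_jet.
  (* The value of the extended operator at [f] is [g] itself, so jets of all orders agree by
     congruence. *)
  exact: app_eq (star_functional (@lpdo_functional _ _ _ io_inj V _ _ P)) fg.
Qed.
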